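(* Let $X$ be a Banach space and $Y$ a closed subspace of $X$. Then: (1) Every $t\in \mathrm{Emb}_{s}(Y,X)$ extends uniquely to some $\tilde t\in\mathrm{Emb}_{s}(\mathrm{Env}(Y),X)$. (2) The image $\tilde t(\mathrm{Env}(Y))$ is equal to $\mathrm{Env}(tY)$. In particular, if $Y$ and $Z$ are strongly isometric subspaces of $X$, then so are $\mathrm{Env}(Y)$ and $\mathrm{Env}(Z)$. Furthermore: (3) If $Y$ is separable, the map $t\mapsto\tilde t$ is SOT-SOT continuous from $\mathrm{Emb}_{s}(Y,X)$ to $\mathrm{Emb}_{s}(\mathrm{Env}(Y),X)$.
   Context: $\mathrm{Isom}(X)$ is the group of surjective linear isometries of $X$; $\mathrm{Emb}(Y,X)$ is the set of linear isometric embeddings of $Y$ into $X$. SOT denotes the topology of pointwise norm convergence. $\mathrm{Emb}_s(Y,X)$ (strong isometric embeddings) is the SOT-closure in $\mathrm{Emb}(Y,X)$ of $\{T|_Y: T\in\mathrm{Isom}(X)\}$. Two subspaces $Y,Z$ of $X$ are strongly isometric if there is a surjective linear isometry $t:Y\to Z$ which, regarded as a map into $X$, belongs to $\mathrm{Emb}_s(Y,X)$. The isometric envelope $\mathrm{Env}(Y)$ is the set of $x\in X$ such that whenever a net $(T_i)_{i}$ in $\mathrm{Isom}(X)$ satisfies $T_i y\to y$ for every $y\in Y$, then $T_i x\to x$. *)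

(* Defs.v *)
From HB Require Import structures.
From mathcomp Require Import all_boot all_order all_algebra.
From mathcomp Require Import all_classical all_reals all_analysis.

Import Order.TTheory GRing.Theory Num.Theory.
Import numFieldNormedType.Exports.

Local Open Scope classical_set_scope.
Local Open Scope ring_scope.

(* Nets are families indexed by a nonempty directed preorder; a net
   [u : I -> T] converges to [l] when [u i @[i --> tails le] --> l]. *)
Record directed {I : Type} (le : I -> I -> Prop) : Prop := Directed {
  directed_inhabited : inhabited I;
  directed_refl : forall i, le i i;
  directed_trans : forall i j k, le i j -> le j k -> le i k;
  directed_ub : forall i j, exists k, le i k /\ le j k
}.

Definition tails {I : Type} (le : I -> I -> Prop) : set_system I :=
  [set A | exists i0, forall i, le i0 i -> A i].

Lemma tails_proper {I : Type} {le : I -> I -> Prop} :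
  directed le -> ProperFilter (tails le).
Proof.
move=> [[i0] lexx le_trans ub]; split; last split.
- by move=> [i /(_ i (lexx i))].
- by exists i0.
- move=> A B [i Ai] [j Bj]; have [k [ik jk]] := ub i j.
  by exists k => l kl; split; [exact/Ai/(le_trans _ _ _ ik)|
                               exact/Bj/(le_trans _ _ _ jk)].
- by move=> A B AB [i Ai]; exists i => j /Ai /AB.
Qed.

Definition separable (T : topologicalType) : Prop :=
  exists2 D : set T, countable D & dense D.

(* Real and complex Banach spaces are the cases [K := R] and [K := R[i]] with
   [R : realType]. *)
Section Envelope.
Context {K : numFieldType} {X : completeNormedModType K}.
Implicit Types Y Z : set X.

Definition closed_subspace Y : Prop := submod_closed [in Y] /\ closed Y.

(* Isom(X) *)
Definition Isom : set (X -> X) :=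
  [set T | [/\ linear T, forall x, `|T x| = `|x| & range T = setT]].

(* Emb(Y,X), as a set of functions defined on the type of elements of [Y].
   Linearity is expressed through the operations of [X], so that [Y : Type]
   need not be given a module structure of its own; [{ptws Y -> X}] carries
   the topology of pointwise norm convergence (SOT). *)
Definition Emb Y : set {ptws Y -> X} :=
  [set t | (forall (a : K) (u v w : Y),
              set_val w = a *: set_val u + set_val v -> t w = a *: t u + t v)
        /\ (forall u : Y, `|t u| = `|set_val u|)].

(* Emb_s(Y,X); [sigL Y T] is the restriction of [T] to [Y]. *)
Definition Emb_s Y : set {ptws Y -> X} :=
  Emb Y `&` closure (sigL Y @` Isom : set {ptws Y -> X}).

Definition strongly_isometric Y Z : Prop :=
  exists2 t : {ptws Y -> X}, Emb_s Y t & range t = Z.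

Definition Env Y : set X :=
  [set x | forall (I : Type) (le : I -> I -> Prop) (T : I -> X -> X),
     directed le -> (forall i, Isom (T i)) ->
     (forall y, Y y -> T i y @[i --> tails le] --> y) ->
     T i x @[i --> tails le] --> x].

Lemma sub_Env Y : Y `<=` Env Y.
Proof. by move=> y Yy I le T _ _; apply. Qed.

(* In particular, linearity in [Emb (Env Y)] has its usual meaning. *)
Lemma Env_subspace Y : closed_subspace (Env Y).
Proof.
split.
  split; first rewrite inE => I le T dle isoT _.
    have FF := tails_proper dle.
    have T0 i : T i 0 = 0.
      by have [_ nT _] := isoT i; apply/eqP; rewrite -normr_eq0 nT normr0.
    by under eq_fun do rewrite T0; exact: cvg_cst.
  move=> a u v; rewrite !inE => Eu Ev I le T dle isoT YT.
  have FF := tails_proper dle.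
  have TE i : T i (a *: u + v) = a *: T i u + T i v.
    by have [lT _ _] := isoT i; rewrite lT.
  under eq_fun do rewrite TE.
  apply: cvgD; last exact: (Ev I le T).
  by apply: cvgZ; [exact: cvg_cst|exact: (Eu I le T)].
move=> x clx I le T dle isoT YT.
have FF := tails_proper dle.
apply/cvgrPdist_lt => e e0.
have e30 : 0 < e / 3 by rewrite divr_gt0.
have [z [Ez]] := clx _ (nbhsx_ballx x _ e30).
rewrite -ball_normE/= => xz.
have /cvgrPdist_lt/(_ _ e30) := Ez I le T dle isoT YT.
apply: filterS => i zTz.
have [lT nT _] := isoT i.
have TB : T i z - T i x = T i (z - x).
  by have := lT (-1) x z; rewrite !scaleN1r => E; rewrite addrC -E addrC.
rewrite -(subrKA z) -(subrKA (T i z) z).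
rewrite (le_lt_trans (ler_normD _ _))//.
have -> : e = e / 3 + (e / 3 + e / 3).
  by rewrite -!mulrDl -mulr2n -mulrS -(mulr_natr e) mulfK// pnatr_eq0.
rewrite ltrD// (le_lt_trans (ler_normD _ _))// ltrD//.
by rewrite TB nT distrC.
Qed.

(* [t' : Env Y -> X] is an extension of [t : Y -> X] in Emb_s(Env(Y),X);
   [subfun (sub_Env Y)] is the inclusion of [Y] into [Env Y]. *)
Definition is_Env_extension {Y} (t : {ptws Y -> X}) (t' : {ptws (Env Y) -> X}) :
  Prop := Emb_s (Env Y) t' /\ t' \o subfun (sub_Env Y) = t.

End Envelope.

(* Main.v *)
Require Import Defs.
From mathcomp Require Import all_boot all_order all_algebra.
From mathcomp Require Import all_classical all_reals all_analysis.
Set Implicit Arguments.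
Unset Strict Implicit.
Unset Printing Implicit Defensive.

Import Order.TTheory GRing.Theory Num.Theory.
Import numFieldNormedType.Exports.

Local Open Scope classical_set_scope.
Local Open Scope ring_scope.

(** The argument rests on turning the definition of the envelope, which speaks
of nets converging to the identity, into a uniform estimate: if [x] is in
[Env Y] and [e > 0], there are finitely many [y_k] in [Y] and radii [d_k > 0]
such that two isometries [S], [T] with [|S y_k - T y_k| < d_k] for all [k]
satisfy [|S x - T x| < e] ([Env_modulus]).  By contraposition, a failure of
such an estimate for [T = id] would produce an isometry for each finite list of
pairs [(y_k, d_k)]; these lists are directed by inclusion, and the resulting
net would converge to the identity on [Y] but not at [x].  One passes from
[T = id] to two isometries by considering the inverse of [S] composed with [T],
because isometries preserve distances.

Elements of [Emb_s Y] are the pointwise limits on [Y] of filters of surjective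
isometries ([Emb_sP]).

- Existence.  If [T] tends to [t] on [Y], then [T y] is Cauchy for [y] in [Y],
  hence by the estimate [T x] is Cauchy for [x] in [Env Y], and converges since
  [X] is complete; the limit is the extension ([Env_cvg]).
- Uniqueness and continuity.  The estimate passes to limits, so it holds with
  two elements of [Emb_s (Env Y)] in place of [S] and [T]
  ([Emb_s_Env_modulus]).  Elements that agree on [Y] therefore agree on
  [Env Y], and closeness at finitely many points of [Y] controls closeness at
  [x]: the extension map is even uniformly continuous.
- Range.  If [T] tends to [t'] on [Env Y], then [t'] maps [Env Y] into
  [Env (range t)] because isometries that almost fix [t y] almost fix [T y]
  ([Env_lim]).  The inverses of [T] tend to the inverse of [t] on [range t], so
  the same argument applied to them gives the other inclusion. *)

(** * Surjective isometries *)

Section isometries.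
Context {K : numFieldType} {X : completeNormedModType K}.
Implicit Types (Y Z : set X) (S T : X -> X).

Lemma IsomB T x y : Isom T -> T (x - y) = T x - T y.
Proof.
by case=> lT _ _; have := lT (-1) y x; rewrite !scaleN1r ![- _ + _]addrC.
Qed.

Lemma Isom_dist T x y : Isom T -> `|T x - T y| = `|x - y|.
Proof. by move=> iT; rewrite -IsomB//; case: iT => _ ->. Qed.

Definition Isom_inv T : X -> X := fun x => xget 0 [set y | T y = x].

Lemma Isom_invK T : Isom T -> cancel (Isom_inv T) T.
Proof.
move=> [_ _ rT] x; apply: (xgetPex 0 (P := [set y | T y = x])).
have [y _ <-] : range T x by rewrite rT.
by exists y.
Qed.

Lemma Isom_inv_dist T x y : Isom T -> `|Isom_inv T x - y| = `|x - T y|.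
Proof. by move=> iT; rewrite -(Isom_dist _ _ iT) Isom_invK. Qed.

Lemma Isom_invP T : Isom T -> Isom (Isom_inv T).
Proof.
move=> iT; have [lT nT _] := iT.
have inv_eq x y : T x = y -> Isom_inv T y = x.
  move=> Txy; apply/eqP.
  by rewrite -subr_eq0 -normr_eq0 Isom_inv_dist// Txy subrr normr0.
split.
- by move=> a x y; apply: inv_eq; rewrite lT !Isom_invK.
- by move=> x; rewrite -nT Isom_invK.
- by rewrite -subTset => x _; exists (T x) => //; exact: inv_eq.
Qed.

Lemma Isom_comp S T : Isom S -> Isom T -> Isom (S \o T).
Proof.
move=> [lS nS rS] [lT nT rT]; split.
- by move=> a x y /=; rewrite lT lS.
- by move=> x /=; rewrite nS nT.
- rewrite -subTset => x _; have [y _ <-] : range S x by rewrite rS.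
  have [z _ <-] : range T y by rewrite rT.
  by exists z.
Qed.

(** * The uniform estimate on the envelope *)

(** The basic neighborhoods of [0] in the topology of pointwise convergence.
As each point carries its own radius, the lists are directed by inclusion, with
concatenation as an upper bound. *)
Definition small {U : Type} (F : seq (U * {posnum K})) (h : U -> X) : bool :=
  all (fun p => `|h p.1| < p.2%:num) F.

Lemma near_small {U J : Type} {G : set_system J} {FG : Filter G}
    (F : seq (U * {posnum K})) (h : J -> U -> X) (l : U -> X) :
  (forall u, h j u @[j --> G] --> l u) -> small F l ->
  \forall j \near G, small F (h j).
Proof.
move=> hl; elim: F => [|[u d] F IHF] /=; first by move=> _; exact: nearW.
move=> /andP[lu /IHF Fl].
have ul : \forall j \near G, `|h j u| < d%:num by exact: cvgr_norm_lt lu.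
by apply: filterS2 ul Fl => j /= -> ->.
Qed.

(** The envelope is defined by nets, with no uniformity; this is the uniformity
that the definition contains, in a form invariant under composing both
isometries with a third one on the left. *)
Lemma Env_modulus Y (x : X) (e : K) : Env Y x -> 0 < e ->
  exists F : seq (Y * {posnum K}), forall S T, Isom S -> Isom T ->
    small F (fun y => S (set_val y) - T (set_val y)) -> `|S x - T x| < e.
Proof.
move=> Ex e0.
suff [F FP] : exists F : seq (Y * {posnum K}), forall T, Isom T ->
    small F (fun y => T (set_val y) - set_val y) -> `|T x - x| < e.
  exists F => S T iS iT FST.
  (* apply the estimate near the identity to the inverse of [S] after [T] *)
  rewrite distrC -Isom_inv_dist//.
  apply: (FP (Isom_inv S \o T)); first exact/Isom_comp/iT/Isom_invP.
  by apply: sub_all FST => p /=; rewrite distrC -Isom_inv_dist.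
apply: contrapT => noF.
pose I := seq (Y * {posnum K}).
pose le (F G : I) := {subset F <= G}.
have dle : directed le.
  split; first exact: inhabits [::].
  - by move=> F.
  - by move=> F G H FG GH p /FG /GH.
  - by move=> F G; exists (F ++ G); split=> p pF; rewrite mem_cat pF ?orbT.
have bad (F : I) : exists T, [/\ Isom T,
    small F (fun y => T (set_val y) - set_val y) & ~ (`|T x - x| < e)].
  apply: contrapT => noT; apply: noF; exists F => T iT FT.
  by apply: contrapT => nTx; apply: noT; exists T.
(* one bad isometry for each list is a net that contradicts [Env Y x] *)
have [T TP] := choice bad.
have FF := tails_proper dle.
have : T F x @[F --> tails le] --> x.
  apply: Ex => // [F|y Yy]; first by have [] := TP F.
  apply/cvgrPdist_lt => _/posnumP[d].
  exists [:: (SigSub (mem_set Yy), d)] => F /(_ _ (mem_head _ _)) dF.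
  by have [_ /allP/(_ _ dF) + _] := TP F; rewrite distrC.
move/cvgrPdist_lt/(_ _ e0)/filter_ex => [F].
by have [_ _] := TP F; rewrite distrC.
Qed.

Lemma Env_asymptotic {J : Type} {G : set_system J} {FG : Filter G}
    (S T : J -> X -> X) Y x :
  (\forall j \near G, Isom (S j)) -> (\forall j \near G, Isom (T j)) ->
  (forall y, Y y -> S j y - T j y @[j --> G] --> 0) ->
  Env Y x -> S j x - T j x @[j --> G] --> 0.
Proof.
move=> iS iT ST Ex; apply/cvgr0Pnorm_lt => e e0.
have [F FP] := Env_modulus Ex e0.
have : \forall j \near G, small F (fun y => S j (set_val y) - T j (set_val y)).
  apply: (near_small (l := fun=> 0)) => [y|]; first exact/ST/set_valP.
  by apply/allP => p _ /=; rewrite normr0.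
by apply: filterS3 iS iT => j iSj iTj Fj; exact: FP.
Qed.

(** * Strong isometric embeddings as limits of isometries *)

Definition approximates (G : set_system (X -> X)) Y (t : Y -> X) : Prop :=
  G Isom /\ forall y : Y, T (set_val y) @[T --> G] --> t y.

(** Linearity and preservation of the norm are closed conditions, so a pointwise
limit of isometries is automatically an isometric embedding. *)
Lemma approximates_Emb (G : set_system (X -> X)) Y (t : Y -> X) :
  ProperFilter G -> approximates G t -> Emb Y t.
Proof.
move=> PG [iG Gt]; split=> [a u v w wE|u].
  apply: (norm_cvg_unique (F := (T (set_val w) @[T --> G]))); first exact: Gt.
  have : a *: T (set_val u) + T (set_val v) @[T --> G] --> a *: t u + t v.
    by apply: cvgD; [apply: cvgZ; [exact: cvg_cst|]|]; exact: Gt.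
  apply: cvg_trans; apply: near_eq_cvg; apply: filterS iG => T [lT _ _].
  by rewrite /= wE lT.
have Gtu : (`|T (set_val u)| : K) @[T --> G] --> (`|t u| : K).
  by apply: cvg_norm; exact: Gt.
apply: (norm_cvg_unique (V := K) Gtu).
apply: (@cvg_trans _ ((`|set_val u| : K) @[_ --> G])); last exact: cvg_cst.
by apply: near_eq_cvg; apply: filterS iG => T [_ nT _]; rewrite /= nT.
Qed.

(** A filter on the restrictions to [Y] lifts to a filter on the isometries
themselves by choosing an isometry above each restriction; working upstairs
allows evaluating the same filter at points outside [Y]. *)
Lemma Emb_sP Y (t : {ptws Y -> X}) :
  Emb_s Y t <-> exists2 G, ProperFilter G & approximates G t.
Proof.
split=> [[_]|[G PG Gt]].
  rewrite closureEcvg => -[H PH [Ht HE]].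
  have lift (f : Y -> X) : exists T : X -> X,
      (sigL Y @` Isom) f -> Isom T /\ sigL Y T = f.
    by have [[T iT TE]|nf] := pselect ((sigL Y @` Isom) f);
      [exists T|exists id].
  have [r rP] := choice lift.
  have {}HE : \forall f \near H, (sigL Y @` Isom) f by exact: HE.
  exists (r @ H); first exact: fmap_proper_filter.
  split; first by apply: filterS HE => f /rP[].
  move=> y; have /pointwise_cvgP/(_ y) Hty := Ht.
  have rE : \forall f \near H, f y = r f (set_val y).
    by apply: filterS HE => f /rP[_ fE]; rewrite -[in LHS]fE.
  exact: cvg_trans (near_eq_cvg rE) Hty.
split; first exact: approximates_Emb Gt.
rewrite closureEcvg; exists (sigL Y @ G); first exact: fmap_proper_filter.
have [iG Gty] := Gt; split.
  by apply/pointwise_cvgP => y; exact: Gty.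
move=> A EA; have : \forall T \near G, A (sigL Y T) by
  apply: filterS iG => T iT; apply: EA; exists T.
exact.
Qed.

(** Convergence on [Y] makes the difference of two independent copies of the
filter tend to [0] on [Y], hence on [Env Y]: the values at [x] are Cauchy. *)
Lemma Env_cvg (G : set_system (X -> X)) Y x : ProperFilter G -> G Isom ->
  (forall y, Y y -> cvg (T y @[T --> G])) -> Env Y x -> cvg (T x @[T --> G]).
Proof.
move=> PG iG Gc Ex; apply: cauchy_cvg; apply/cauchy_ballP => e e0.
have : p.1 x - p.2 x @[p --> (G, G)] --> 0.
  apply: Env_asymptotic Ex.
  - exact: cvg_fst.
  - exact: cvg_snd.
  - move=> y /Gc/cvg_ex[l Gl]; rewrite -(subrr l).
    by apply: cvgB; [exact: (cvg_comp _ _ cvg_fst Gl)|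
                     exact: (cvg_comp _ _ cvg_snd Gl)].
move/cvgr0Pnorm_lt/(_ _ e0) => -[[A B] /= [GA GB] AB].
exists ([set T x | T in A], [set T x | T in B]) => /=.
  by split; [apply: filterS GA|apply: filterS GB] => T AT; exists T.
by move=> [_ _] [[S AS <-] [T BT <-]]; rewrite -ball_normE; exact: (AB (S, T)).
Qed.

(** Replacing [w j] by its limit [z] changes [S j (w j) - w j] by at most
[2 |w j - z|], since [S j] preserves distances. *)
Lemma Isom_drift {J : Type} {G : set_system J} {FG : Filter G}
    (S : J -> X -> X) (w : J -> X) z : (\forall j \near G, Isom (S j)) ->
  w j @[j --> G] --> z ->
  (S j (w j) - w j @[j --> G] --> 0) <-> (S j z @[j --> G] --> z).
Proof.
move=> iS wz.
have wz0 : w j - z @[j --> G] --> 0 by apply/subr_cvg0.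
have Swz : S j (w j) - S j z @[j --> G] --> 0.
  apply/cvgr0Pnorm_lt => e e0.
  have /cvgr0Pnorm_lt/(_ _ e0) := wz0.
  by apply: filterS2 iS => j iSj; rewrite Isom_dist.
have SwzE : (S j (w j) - w j) - (S j z - z) @[j --> G] --> 0.
  rewrite -(subr0 0) (_ : (fun j => _) =
      (fun j => S j (w j) - S j z) - (fun j => w j - z)); first exact: cvgB.
  apply/funext => j /=.
  by rewrite !opprB [z - S j z]addrC addrACA [- _ + z]addrC.
split=> [Sw|/subr_cvg0 Sz].
  apply/subr_cvg0.
  rewrite -(subr0 0) (_ : (fun j => _) = (fun j => S j (w j) - w j) -
      (fun j => (S j (w j) - w j) - (S j z - z))); first exact: cvgB.
  by apply/funext => j; rewrite /= subKr.
rewrite -(addr0 0) (_ : (fun j => _) =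
    (fun j => (S j (w j) - w j) - (S j z - z)) + (fun j => S j z - z)).
  exact: cvgD.
by apply/funext => j; rewrite /= subrK.
Qed.

(** Limits of isometries carry envelopes into envelopes.  Suppose that [S] tends
to the identity on [Z].  As [T y] tends to a point of [Z], the isometries [S]
almost fix [T y], that is, [S \o T] and [T] become close on [Y].  They then
become close at [x], so [S] almost fixes [T x], and hence its limit [x'].  The
two limits are taken along a product filter because [S] and [T] vary
independently. *)
Lemma Env_lim (G : set_system (X -> X)) Y Z (x x' : X) :
  ProperFilter G -> G Isom ->
  (forall y, Y y -> exists2 z, Z z & T y @[T --> G] --> z) ->
  Env Y x -> T x @[T --> G] --> x' -> Env Z x'.
Proof.
move=> PG iG GYZ Ex Gx I le S dle iS SZ.
have FF := tails_proper dle.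
pose H := filter_prod (tails le) G.
have iSH : \forall p \near H, Isom (S p.1) by exact: nearW.
have iTH : \forall p \near H, Isom p.2 by exact: cvg_snd.
have GH (z z' : X) : T z @[T --> G] --> z' -> p.2 z @[p --> H] --> z'.
  exact: (cvg_comp _ _ cvg_snd).
have drift (z z' : X) : T z @[T --> G] --> z' ->
    (S p.1 (p.2 z) - p.2 z @[p --> H] --> 0) <-> (S p.1 z' @[p --> H] --> z').
  by move=> /GH h; exact: (Isom_drift iSH h).
have /cvgrPdist_lt Sx' : S p.1 x' @[p --> H] --> x'.
  apply/(drift _ _ Gx).
  apply: (Env_asymptotic (S := fun p => S p.1 \o p.2) (T := snd)) Ex => //.
    by apply: filterS iTH => p; exact: Isom_comp.
  move=> y /GYZ[z /SZ Sz Gy]; apply/(drift _ _ Gy).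
  exact: (cvg_comp _ _ cvg_fst Sz).
(* [S p.1 x'] does not depend on [p.2], and [G] is proper *)
apply/cvgrPdist_lt => e /Sx'[[A B] /= [HA GB] AB].
have [T BT] := filter_ex GB.
by apply: filterS HA => i Ai; exact: (AB (i, T)).
Qed.

(** The estimate of [Env_modulus] survives in the limit: being [small] is an
open condition, so it passes to the isometries that approximate [t] and [s],
and the remaining half of [e] absorbs the approximation error at [x]. *)
Lemma Emb_s_Env_modulus Y (x : Env Y) (e : K) : 0 < e ->
  exists F : seq (Y * {posnum K}), forall t s : {ptws (Env Y) -> X},
    Emb_s (Env Y) t -> Emb_s (Env Y) s ->
    small F (fun y => t (subfun (sub_Env Y) y) -
                      s (subfun (sub_Env Y) y)) ->
    `|t x - s x| < e.
Proof.
move=> e0; have e20 : 0 < e / 2 by rewrite divr_gt0.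
have [F FP] := Env_modulus (set_valP x) e20.
exists F => t s /Emb_sP[G PG [iG Gt]] /Emb_sP[H PH [iH Hs]] Fts.
have GHts (z : Env Y) :
    p.1 (set_val z) - p.2 (set_val z) @[p --> (G, H)] --> t z - s z.
  by apply: cvgB; [exact: (cvg_comp _ _ cvg_fst (Gt z))|
                   exact: (cvg_comp _ _ cvg_snd (Hs z))].
have iG1 : \forall p \near (G, H), Isom p.1 by exact: cvg_fst.
have iH2 : \forall p \near (G, H), Isom p.2 by exact: cvg_snd.
have small_near : \forall p \near (G, H),
    small F (fun y => p.1 (set_val y) - p.2 (set_val y)).
  exact: near_small (fun y : Y => GHts (subfun (sub_Env Y) y)) Fts.
have /cvgrPdist_lt/(_ _ e20) xnear := GHts x.
have [p] := filter_ex (filterI (filterI iG1 iH2) (filterI small_near xnear)).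
move=> [[ip1 ip2] [/(FP _ _ ip1 ip2) px1 px2]].
rewrite -(subrK (p.1 (set_val x) - p.2 (set_val x)) (t x - s x)).
by rewrite (le_lt_trans (ler_normD _ _))// (splitr e) ltrD.
Qed.

(** * The extension to the envelope *)

Lemma Env_extension_exists Y (t : {ptws Y -> X}) : Emb_s Y t ->
  exists t', is_Env_extension t t'.
Proof.
move=> /Emb_sP[G PG [iG Gt]].
have Gc (x : Env Y) : cvg (T (set_val x) @[T --> G]).
  apply: Env_cvg (set_valP x) => // y Yy.
  by apply/cvg_ex; exists (t (SigSub (mem_set Yy))); exact: Gt.
exists (fun x => lim (T (set_val x) @[T --> G])); split.
  by apply/Emb_sP; exists G => //; split=> // x; exact: Gc.
apply/funext => y /=; apply: cvg_lim; first exact: norm_hausdorff.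
exact: Gt.
Qed.

Lemma Env_extension_unique Y (t : {ptws Y -> X}) (t1 t2 : {ptws (Env Y) -> X}) :
  is_Env_extension t t1 -> is_Env_extension t t2 -> t1 = t2.
Proof.
move=> [Et1 t1E] [Et2 t2E]; apply/funext => x.
apply/eqP; rewrite -subr_eq0 -normr_eq0; apply: contrapT => /negP ne0.
have [|F FP] := @Emb_s_Env_modulus Y x `|t1 x - t2 x|.
  by rewrite lt_neqAle eq_sym ne0 normr_ge0.
suff : `|t1 x - t2 x| < `|t1 x - t2 x| by rewrite ltxx.
apply: FP => //.
apply/allP => p _; have := congr1 (fun f => f p.1) (etrans t1E (esym t2E)).
by move=> /= ->; rewrite subrr normr0.
Qed.

(** Given [w] in [Env (range t)], its preimage is the limit [x] of [T^-1 w],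
which exists by [Env_cvg] and lies in [Env Y] by [Env_lim], both applied to the
inverses of the isometries approximating [t']. *)
Lemma range_Env_extension Y (t : {ptws Y -> X}) (t' : {ptws (Env Y) -> X}) :
  is_Env_extension t t' -> range t' = Env (range t).
Proof.
move=> [/Emb_sP[G PG [iG Gt']] t'E].
have Gt (y : Y) : T (set_val y) @[T --> G] --> t y.
  by rewrite -t'E; exact: (Gt' (subfun (sub_Env Y) y)).
apply/seteqP; split=> [_ [x _ <-]|w Ew].
  apply: Env_lim (set_valP x) (Gt' x) => // y Yy.
  exists (t (SigSub (mem_set Yy))); last exact: Gt.
  by exists (SigSub (mem_set Yy)).
(* the inverses move [t y] back to [y] *)
have G_inv z z' : T z @[T --> G] --> z' <-> Isom_inv T z' @[T --> G] --> z.
  split=> /cvgrPdist_lt Gz; apply/cvgrPdist_lt => e /Gz.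
    by apply: filterS2 iG => T iT; rewrite [ `|z - _|]distrC Isom_inv_dist.
  by apply: filterS2 iG => T iT; rewrite [ `|z - _|]distrC Isom_inv_dist.
have iG' : \forall T \near G, Isom (Isom_inv T).
  by apply: filterS iG => T; exact: Isom_invP.
have G't z : range t z -> exists2 y, Y y & Isom_inv T z @[T --> G] --> y.
  move=> [y _ <-]; exists (set_val y); first exact: set_valP.
  exact/G_inv.
have PG' : ProperFilter (Isom_inv @ G) by exact: fmap_proper_filter.
have /cvg_ex[x Gx] : cvg (T w @[T --> Isom_inv @ G]).
  apply: Env_cvg Ew => // z /G't[y _ Gy].
  by apply/cvg_ex; exists y; exact: Gy.
have Ex : Env Y x by apply: Env_lim Ew Gx.
exists (SigSub (mem_set Ex)) => //.
apply: (norm_cvg_unique (F := (T x @[T --> G]))).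
  exact: (Gt' (SigSub (mem_set Ex))).
exact/G_inv.
Qed.

Lemma ptws_eval_cvg Y (t : {ptws Y -> X}) (y : Y) :
  s y @[s --> t] --> t y.
Proof.
have [/(_ cvg_id) + _] := @pointwise_cvgP Y X (nbhs t) t (nbhs_filter t).
exact.
Qed.

Lemma near_small_sub Y (t : {ptws Y -> X}) (F : seq (Y * {posnum K})) :
  \forall s \near t, small F (fun y => t y - s y).
Proof.
have nbhsF := nbhs_filter t.
have ts0 y : t y - s y @[s --> t] --> 0.
  by apply/cvgr0Pnorm_lt; exact/cvgrPdist_lt/ptws_eval_cvg.
by apply: (near_small ts0); apply/allP => p _ /=; rewrite normr0.
Qed.

(** The radii given by [Emb_s_Env_modulus] do not depend on the embeddings, and
an extension is determined on [Y] by the embedding it extends. *)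
Lemma Env_extension_continuous Y
    (ext : {ptws Y -> X} -> {ptws (Env Y) -> X}) :
  (forall t, Emb_s Y t -> is_Env_extension t (ext t)) ->
  {within Emb_s Y, continuous ext}.
Proof.
move=> extP; apply/subspace_continuousP => t Et.
apply/pointwise_cvgP => x; apply/cvgrPdist_lt => e /(Emb_s_Env_modulus x)[F FP].
have [Eext extE] := extP _ Et.
have nbhsF := nbhs_filter (t : {ptws Y -> X}).
have Fsmall := near_small_sub t F.
apply: filterS Fsmall => s Fs Es; have [Eexts extsE] := extP _ Es.
apply: FP => //; move: Fs; rewrite -{1}extE -{1}extsE.
exact.
Qed.

End isometries.

Theorem proposition2p32 (K : numFieldType) (X : completeNormedModType K)
    (Y : set X) (subY : closed_subspace Y) :
  [/\ (forall t : {ptws Y -> X}, Emb_s Y t ->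
         exists! t' : {ptws (Env Y) -> X}, is_Env_extension t t'),
      (forall (t : {ptws Y -> X}) (t' : {ptws (Env Y) -> X}), Emb_s Y t ->
         is_Env_extension t t' -> range t' = Env (range t)),
      (forall Z : set X, closed_subspace Z ->
         strongly_isometric Y Z -> strongly_isometric (Env Y) (Env Z)) &
      (separable Y ->
       forall ext : {ptws Y -> X} -> {ptws (Env Y) -> X},
         (forall t, Emb_s Y t -> is_Env_extension t (ext t)) ->
         {within Emb_s Y, continuous ext})].
Proof.
split.
- move=> t /Env_extension_exists[t' tt']; exists t'; split=> // s ts.
  exact: Env_extension_unique ts.
- by move=> t t' _; exact: range_Env_extension.
- move=> Z _ [t Et <-]; have [t' tt'] := Env_extension_exists Et.
  by exists t'; [case: tt'|exact: range_Env_extension].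
- by move=> _; exact: Env_extension_continuous.
Qed.
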